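(* With ${\cal U}$ and ${\cal W}$ as defined in the context, the stratum ${\cal W}$ belongs to the closure of the stratum ${\cal U}$.
   Context: Let $\alpha_j,\beta_j\in{\bf C}^*$, $\alpha_j\ne\beta_j$, $j=1,2,3$, satisfy $\alpha_1\beta_1\alpha_2\beta_2\alpha_3\beta_3=1$ and be relatively generic: for integers $m\in\{1,2,3\}$ and $k_1,k_2,k_3$ with $0\le k_j\le2$, $0\le m-k_j\le2$, the equality $(-1)^m\prod_{j=1}^3\alpha_j^{k_j}\beta_j^{m-k_j}=1$ holds only for $m=2$, $k_1=k_2=k_3=1$. For $j=1,2,3$ let $C_j\subset GL(4,{\bf C})$ be the conjugacy class of diagonalizable matrices with eigenvalues $\alpha_j,\beta_j$, each of multiplicity $2$; let $C_4$ be the conjugacy class of matrices with the single eigenvalue $-1$ and with three Jordan blocks, of sizes $2,1,1$. Set ${\cal V}=\{(M_1,\ldots,M_4)~|~M_j\in C_j,~M_1M_2M_3M_4=I\}$. Quadruples of matrices $N_j\in GL(2,{\bf C})$: $N_j$ is diagonalizable with eigenvalues $\alpha_j,\beta_j$ for $j=1,2,3$, $N_4=-I$, $N_1N_2N_3N_4=I$. Quadruples of matrices $P_j\in GL(2,{\bf C})$: $P_j$ is diagonalizable with eigenvalues $\alpha_j,\beta_j$ for $j=1,2,3$, $P_4$ is conjugate to a Jordan block of size $2$ with eigenvalue $-1$, $P_1P_2P_3P_4=I$. (By the genericity of the eigenvalues all such quadruples are irreducible.) ${\cal U}$ is the set of quadruples in ${\cal V}$ which are simultaneously conjugate to a quadruple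 $M_j=\left(\begin{array}{cc}N_j&0\\0&P_j\end{array}\right)$ with $(N_j)$, $(P_j)$ as described. ${\cal W}$ is the set of quadruples in ${\cal V}$ which are simultaneously conjugate to a quadruple $M_j=\left(\begin{array}{cc}N_j&R_j\\0&N_j\end{array}\right)$ with $(N_j)$ as described, $R_j\in gl(2,{\bf C})$ (so $M_1,M_2,M_3$ are diagonalizable and ${\rm rk}\,R_4=1$). Closure may be taken in the classical topology. *)

(* Defs.v *)
(* MathComp / MathComp-Analysis. *)
From HB Require Import structures.
From mathcomp Require Import all_boot all_order all_algebra.
From mathcomp Require Import all_classical all_reals topology normedtype.
From mathcomp Require Export complex.

Set Implicit Arguments.
Unset Strict Implicit.
Unset Printing Implicit Defensive.

Import Order.TTheory GRing.Theory Num.Theory.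
Import numFieldNormedType.Exports.

Local Open Scope classical_set_scope.
Local Open Scope ring_scope.

(* Over K = R[i] with R : realType, the topology which normedtype puts on a
   numFieldType is that of the complex modulus. *)

Definition quad (K : numFieldType) (n : nat) := 'I_4 -> 'M[K]_n.

(* The indices 1, 2, 3, 4 are shifted to 0, 1, 2, 3; the eigenvalues are
   indexed by 'I_3, and [first3 j] is j seen in 'I_4. *)
Definition first3 (j : 'I_3) : 'I_4 := widen_ord (leqnSn 3) j.

Definition prod_one (K : numFieldType) (n : nat) (M : quad K n) : Prop :=
  \big[mulmx/1%:M]_(j < 4) M j = 1%:M.

Definition relatively_generic (K : numFieldType) (a b : 'I_3 -> K) : Prop :=
  forall (m : nat) (k : 'I_3 -> nat),
    (1 <= m <= 3)%N ->
    (forall j, [/\ (k j <= 2)%N, (k j <= m)%N & (m - k j <= 2)%N]) ->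
    (-1) ^+ m * \prod_(j < 3) (a j ^+ k j * b j ^+ (m - k j)) = 1 ->
    m = 2%N /\ forall j, k j = 1%N.

(* The characteristic polynomial forces n = 2 * r. *)
Definition diag_class (K : numFieldType) (n r : nat) (x y : K) (A : 'M[K]_n) :
    Prop :=
  diagonalizable A /\
  char_poly A = ('X - x%:P) ^+ r * ('X - y%:P) ^+ r.

Definition jordan_block (K : numFieldType) (x : K) (n : nat) : 'M[K]_n :=
  \matrix_(i < n, j < n) (x *+ (i == j) + (i.+1 == j :> nat)%:R).

Definition jordan211 (K : numFieldType) (x : K) : 'M[K]_4 :=
  block_mx (jordan_block x 2) 0
           0 (block_mx (jordan_block x 1) 0 0 (jordan_block x 1)).

Definition calV (K : numFieldType) (a b : 'I_3 -> K) : set (quad K 4) :=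
  [set M | [/\ forall j, diag_class 2 (a j) (b j) (M (first3 j)),
               similar_in unitmx (M ord_max) (jordan211 (-1)) & prod_one M]].

Definition quadN (K : numFieldType) (a b : 'I_3 -> K) : set (quad K 2) :=
  [set N | [/\ forall j, diag_class 1 (a j) (b j) (N (first3 j)),
               N ord_max = - 1%:M & prod_one N]].

Definition quadP (K : numFieldType) (a b : 'I_3 -> K) : set (quad K 2) :=
  [set P | [/\ forall j, diag_class 1 (a j) (b j) (P (first3 j)),
               similar_in unitmx (P ord_max) (jordan_block (-1) 2) & prod_one P]].

Definition sim_conj (K : numFieldType) (n : nat) (M M' : quad K n) : Prop :=
  exists2 Q : 'M[K]_n, Q \in unitmx & forall j, similar Q (M j) (M' j).

Definition calU (K : numFieldType) (a b : 'I_3 -> K) : set (quad K 4) :=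
  [set M | calV a b M /\
    exists N P : quad K 2, [/\ quadN a b N, quadP a b P &
      sim_conj M (fun j => block_mx (N j) 0 0 (P j))]].

Definition calW (K : numFieldType) (a b : 'I_3 -> K) : set (quad K 4) :=
  [set M | calV a b M /\
    exists N R : quad K 2, quadN a b N /\
      sim_conj M (fun j => block_mx (N j) (R j) 0 (N j))].

(* Main.v *)
(* Let M be conjugate to the blocks (N_j R_j; 0 N_j).  If P(t) is a quadruple of
   type (P_j) with P_j(t) = N_j + t D_j(t) and D_j(t) -> R_j, then conjugating
   diag(N_j, P_j(t)) by the unipotent matrix with off-diagonal block -1/t gives
   the blocks (N_j D_j(t); 0 P_j(t)), which tend to (N_j R_j; 0 N_j).  So it is
   enough to realise (R_j) as the tangent at t = 0 of such a curve P(t).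

   Take P_4 = -1 + t R_4, move N_1 and N_2 inside their conjugacy classes along
   rational curves with velocities R_1 and R_2, and let P_3 = (P_4 P_1 P_2)^-1.
   Since det P_3 is right, P_3 lies in its class as soon as its trace does, and
   the tangency of R_3 says that this holds up to O(t^2).  The error is removed by
   adding a multiple t s(t) Z(t), s(t) -> 0, of a nilpotent matrix Z(t) whose
   addition keeps P_2 in its class.  The equation for s(t) is linear, and it is
   solvable because N_1 and N_2 have no common eigenvector, by genericity. *)
Require Import Defs.
From HB Require Import structures.
From mathcomp Require Import all_boot all_order all_algebra.
From mathcomp Require Import all_classical all_reals topology normedtype.
From mathcomp Require Import ring.

Import Order.TTheory GRing.Theory Num.Theory.
Import numFieldNormedType.Exports ArrowAsProduct.

Local Open Scope classical_set_scope.
Local Open Scope ring_scope.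

Set Implicit Arguments.
Unset Strict Implicit.
Unset Printing Implicit Defensive.

(** * Entrywise limits of matrices along a filter *)

Section Limits.
Variables (K : numFieldType) (T : Type) (F : set_system T).
Context {FF : Filter F}.
Implicit Types m n p : nat.

Lemma cvg_mxP m n (f : T -> 'M[K]_(m, n)) (A : 'M[K]_(m, n)) :
  f @ F --> A <-> forall i j, f t i j @[t --> F] --> A i j.
Proof.
split=> [fA i j|fA].
  exact: (cvg_comp f (fun M : 'M[K]_(m, n) => M i j) fA (@coord_continuous _ _ _ i j A)).
move=> B [P AP sPB].
have : \forall t \near F, forall i j, P i j (f t i j).
  apply: filter_forall => i; apply: filter_forall => j.
  exact: fA.
by apply: filterS => t Pt; apply: sPB.
Qed.

Lemma cvg_mulmx m n p (f : T -> 'M[K]_(m, n)) (g : T -> 'M[K]_(n, p))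
    (A : 'M[K]_(m, n)) (B : 'M[K]_(n, p)) :
  f @ F --> A -> g @ F --> B -> (f t *m g t) @[t --> F] --> A *m B.
Proof.
move=> /cvg_mxP fA /cvg_mxP gB; apply/cvg_mxP => i j.
under eq_fun do rewrite mxE.
rewrite mxE.
apply: (cvg_big _ (Ff := fun k t => f t i k * g t k j)) => [|k _].
  exact: add_continuous.
exact: cvgM.
Qed.

Lemma cvg_mxtrace n (f : T -> 'M[K]_n) (A : 'M[K]_n) :
  f @ F --> A -> \tr (f t) @[t --> F] --> \tr A.
Proof.
move=> /cvg_mxP fA; apply: (cvg_big _ (Ff := fun i t => f t i i)) => [|i _].
  exact: add_continuous.
exact: fA.
Qed.

Lemma cvg_block_mx m1 m2 n1 n2 (f : T -> 'M[K]_(m1, n1)) (g : T -> 'M[K]_(m1, n2))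
    (h : T -> 'M[K]_(m2, n1)) (k : T -> 'M[K]_(m2, n2))
    (A : 'M[K]_(m1, n1)) (B : 'M[K]_(m1, n2)) (C : 'M[K]_(m2, n1)) (D : 'M[K]_(m2, n2)) :
  f @ F --> A -> g @ F --> B -> h @ F --> C -> k @ F --> D ->
  block_mx (f t) (g t) (h t) (k t) @[t --> F] --> block_mx A B C D.
Proof.
move=> /cvg_mxP fA /cvg_mxP gB /cvg_mxP hC /cvg_mxP kD; apply/cvg_mxP => i j.
case: (split_ordP i) => i' ->; case: (split_ordP j) => j' ->.
- rewrite block_mxEul; under eq_fun do rewrite block_mxEul; exact: fA.
- rewrite block_mxEur; under eq_fun do rewrite block_mxEur; exact: gB.
- rewrite block_mxEdl; under eq_fun do rewrite block_mxEdl; exact: hC.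
- rewrite block_mxEdr; under eq_fun do rewrite block_mxEdr; exact: kD.
Qed.

End Limits.

(** Quadruples carry the product topology, so convergence of each component brings [f t] into any
    neighbourhood of [M], and the filter [0^'] is proper. *)
Lemma closure_cvg (K : numFieldType) (n : nat) (S : set (quad K n))
    (M : quad K n) (f : K -> quad K n) :
  (forall j, f t j @[t --> 0^'] --> M j) ->
  (\forall t \near 0^', S (f t)) -> closure S M.
Proof.
move=> fM fS B MB.
have fB : \forall t \near 0^', B (f t).
  suff : f @ 0^' --> M by apply.
  apply/cvg_sup => j C [D [[E oE <-] /= EM] sEC].
  apply: (@filterS _ _ _ (fun t => E (f t j))); first by move=> t Et; exact: sEC.
  by apply: (fM j); exact: open_nbhs_nbhs.
have [t [St Bt]] := filter_ex (filterI fS fB).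
by exists (f t).
Qed.

(** * Identities for 2 by 2 matrices *)

Section Mx22.
Variable R : comNzRingType.
Implicit Types A B : 'M[R]_2.

Lemma mulmx22E m n (A : 'M[R]_(m, 2)) (B : 'M[R]_(2, n)) i j :
  (A *m B) i j = A i 0 * B 0 j + A i 1 * B 1 j.
Proof.
rewrite mxE !big_ord_recl big_ord0 addr0.
by congr (_ + A i _ * B _ j); apply/val_inj.
Qed.

Lemma mxtrace22E A : \tr A = A 0 0 + A 1 1.
Proof.
rewrite /mxtrace !big_ord_recl big_ord0 addr0.
by congr (_ + A _ _); apply/val_inj.
Qed.

Lemma det22E A : \det A = A 0 0 * A 1 1 - A 0 1 * A 1 0.
Proof.
rewrite (expand_det_row _ 0) !big_ord_recl big_ord0 addr0 /cofactor !det_mx11 !mxE /=.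
have -> : lift 0 0 = 1 :> 'I_2 by apply/val_inj.
have -> : lift 1 0 = 0 :> 'I_2 by apply/val_inj.
by rewrite /= expr0 expr1; ring.
Qed.

Lemma ord2P (k : 'I_2) : k = 0 \/ k = 1.
Proof. by case: k => [[|[|//]] lt]; [left|right]; apply/val_inj. Qed.

Lemma matrix22P A B :
  [/\ A 0 0 = B 0 0, A 0 1 = B 0 1, A 1 0 = B 1 0 & A 1 1 = B 1 1] -> A = B.
Proof.
case=> A00 A01 A10 A11; apply/matrixP => i j.
by case: (ord2P i) => ->; case: (ord2P j) => ->.
Qed.

Lemma detD22 A B :
  \det (A + B) = \det A + \det B + (\tr A * \tr B - \tr (A *m B)).
Proof. by rewrite !det22E !mxtrace22E !mulmx22E !mxE; ring. Qed.

Lemma Cayley_Hamilton22 A : A *m A = \tr A *: A - (\det A)%:M.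
Proof.
by apply: matrix22P; rewrite !mulmx22E mxtrace22E det22E !mxE /=; split; ring.
Qed.

End Mx22.

(** * Conjugacy classes of diagonalizable matrices *)

Lemma char_poly22 (R : comNzRingType) (A : 'M[R]_2) :
  char_poly A = 'X^2 - (\tr A)%:P * 'X + (\det A)%:P.
Proof.
rewrite /char_poly !det22E mxtrace22E /char_poly_mx !mxE /= !rmorphD !rmorphN !rmorphM /=.
by rewrite !mulr1n !mulr0n; ring.
Qed.

(** The minimal polynomial of a diagonalizable matrix is a product of distinct linear factors, and
    its roots are roots of the characteristic polynomial, hence [a] or [b]. *)
Lemma diag_class_annihilate (K : numFieldType) n r (a b : K) (A : 'M[K]_n.+1) :
  diag_class r.+1 a b A -> (A - a%:M) *m (A - b%:M) = 0.
Proof.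
case=> [[P Pu PA]] cA; set p := ('X - a%:P) * ('X - b%:P).
suff /mxminpoly_minP : mxminpoly A %| p.
  by rewrite rmorphM /= !rmorphB /= !horner_mx_X !horner_mx_C.
have := similar_diag_mxminpoly Pu PA; set rs := undup _ => mE.
rewrite mE uniq_roots_dvdp //; last by rewrite uniq_rootsE undup_uniq.
apply/allP => x xrs.
have : root (mxminpoly A) x by rewrite mE root_prod_XsubC.
by rewrite root_mxminpoly cA /p !rootM !root_exp_XsubC !root_XsubC.
Qed.

Lemma diagonalizable_annihilate (K : numFieldType) n (a b : K) (A : 'M[K]_n.+1) :
  a != b -> (A - a%:M) *m (A - b%:M) = 0 -> diagonalizable A.
Proof.
move=> ab A0; apply/diagonalizableP; exists [:: a; b].
  by rewrite /= inE ab.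
rewrite !big_cons big_nil mulr1; apply/mxminpoly_minP.
by rewrite rmorphM /= !rmorphB /= !horner_mx_X !horner_mx_C.
Qed.

(** This turns membership in the class into two scalar equations, which a deformation can be made to
    satisfy. For the converse, Cayley-Hamilton gives an annihilating polynomial with distinct
    roots. *)
Lemma diag_class22P (K : numFieldType) (a b : K) (A : 'M[K]_2) : a != b ->
  diag_class 1 a b A <-> \tr A = a + b /\ \det A = a * b.
Proof.
move=> ab; split=> [[_]|[trA detA]].
  rewrite !expr1 => cA.
  have trE := char_poly_trace A (isT : (0 < 2)%N).
  have detE := char_poly_det A.
  rewrite cA [_ * _](_ : _ = 'X^2 - (a + b)%:P * 'X + (a * b)%:P) in trE detE; last first.
    by rewrite rmorphD rmorphM /=; ring.
  split.
    by move/eqP: trE; rewrite !coefE /= mulr1 add0r addr0 eqr_opp => /eqP ->.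
  by move: detE; rewrite !coefE /= mulr0 subr0 add0r sqrrN expr1n mul1r => ->.
have cA : char_poly A = ('X - a%:P) ^+ 1 * ('X - b%:P) ^+ 1.
  by rewrite char_poly22 trA detA rmorphD rmorphM /=; ring.
split=> //; apply: (diagonalizable_annihilate ab).
have := Cayley_Hamilton A; rewrite cA.
by rewrite !expr1 rmorphM /= !rmorphB /= !horner_mx_X !horner_mx_C.
Qed.

Lemma char_poly_block (R : comNzRingType) n1 n2 (A : 'M[R]_n1) (B : 'M[R]_n2) :
  char_poly (block_mx A 0 0 B) = char_poly A * char_poly B.
Proof.
rewrite /char_poly -(det_ublock _ 0); congr (\det _).
rewrite /char_poly_mx map_block_mx !map_mx0 scalar_mx_block opp_block_mx.
by rewrite add_block_mx !oppr0 !addr0.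
Qed.

Lemma char_poly_conj (F : fieldType) n (P A B : 'M[F]_n) :
  P \in unitmx -> P *m A = B *m P -> char_poly A = char_poly B.
Proof.
move=> Pu PA; pose P' := map_mx (@polyC F) P.
have PP : P' *m char_poly_mx A = char_poly_mx B *m P'.
  by rewrite /char_poly_mx mulmxBr mulmxBl -!map_mxM PA scalar_mxC.
have /(congr1 determinant) := PP; rewrite !det_mulmx mulrC.
by apply: mulIf; rewrite det_map_mx polyC_eq0 -unitfE.
Qed.

Lemma similar_in_trans (F : fieldType) n (A B C : 'M[F]_n) :
  similar_in unitmx A B -> similar_in unitmx B C -> similar_in unitmx A C.
Proof.
move=> [P Pu /(similarP Pu) PA] [Q Qu /(similarP Qu) QB].
exists (Q *m P); first by rewrite unitmx_mul Qu.
by apply/similarP; rewrite ?unitmx_mul ?Qu // -mulmxA PA !mulmxA QB.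
Qed.

Lemma diag_class_similar (K : numFieldType) n r (a b : K) (A B : 'M[K]_n) :
  similar_in unitmx A B -> diag_class r a b B -> diag_class r a b A.
Proof.
move=> AB [[Q Qu /similar_diagPex[d Qd]] cB]; split; last first.
  by rewrite -cB; case: AB => P Pu /(similarP Pu); apply: char_poly_conj.
have [P Pu Pd] : similar_in unitmx A (diag_mx d).
  by apply: similar_in_trans AB _; exists Q.
by exists P => //; apply/similar_diagPex; exists d.
Qed.

Lemma diag_class_block (K : numFieldType) (a b : K) (A B : 'M[K]_2) : a != b ->
  diag_class 1 a b A -> diag_class 1 a b B ->
  diag_class 2 a b (block_mx A 0 0 B).
Proof.
move=> ab dA dB; split; last first.
  by rewrite char_poly_block dA.2 dB.2 !expr1 expr2; ring.
apply: (diagonalizable_annihilate (n := 3) ab).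
suff : (block_mx A 0 0 B - a%:M) *m (block_mx A 0 0 B - b%:M) = 0 :> 'M_(2 + 2) by [].
rewrite !scalar_mx_block !opp_block_mx !add_block_mx mulmx_block !oppr0 !addr0.
rewrite !mul0mx !mulmx0 !add0r !addr0.
by rewrite (diag_class_annihilate dA) (diag_class_annihilate dB) block_mx0.
Qed.

(** * Jordan forms with a single block of size 2 *)

Lemma jordan_block1 (K : numFieldType) (x : K) : jordan_block x 1 = x%:M.
Proof. by apply/matrixP => i j; rewrite !ord1 !mxE /= addr0. Qed.

Lemma similar_jordan_block2 (K : numFieldType) (x : K) (E : 'M[K]_2) :
  E != 0 -> \tr E = 0 -> \det E = 0 ->
  similar_in unitmx (x%:M + E) (jordan_block x 2).
Proof.
move=> E0 trE detE.
have EE : E *m E = 0.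
  by rewrite Cayley_Hamilton22 trE detE scale0r raddf0 subr0.
(* The rows e_i and e_i E form a Jordan basis as soon as they are independent. *)
pose S i : 'M[K]_2 := \matrix_(k, l) (if k == 0 then (l == i)%:R else E i l).
have EE0 i l : E i 0 * E 0 l + E i 1 * E 1 l = 0 by rewrite -mulmx22E EE mxE.
have JE : jordan_block x 2 = x%:M + delta_mx 0 1.
  by apply: matrix22P; rewrite !mxE /=; split; ring.
have SE i : (i == 0) || (i == 1) -> S i *m (x%:M + E) = jordan_block x 2 *m S i.
  rewrite JE mulmxDl mulmxDr mul_mx_scalar mul_scalar_mx => i01; congr (_ + _).
  apply: matrix22P; rewrite !mulmx22E !mxE /= !EE0.
  by case/orP: i01 => /eqP ->; split=> /=; ring.
have S_similar i : (i == 0) || (i == 1) -> \det (S i) != 0 ->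
    similar_in unitmx (x%:M + E) (jordan_block x 2).
  move=> i01; rewrite -unitfE -unitmxE => Su.
  by exists (S i) => //; apply/similarP => //; exact: SE.
have tr0 : E 1 1 = - E 0 0.
  by move: trE; rewrite mxtrace22E addrC => /eqP; rewrite addr_eq0 => /eqP.
(* [S 0] and [S 1] have determinants [E 0 1] and [- E 1 0]; if both vanish, zero trace and
   determinant force [E = 0]. *)
have [E01|] := eqVneq (E 0 1) 0; last first.
  by move=> E01; apply: (S_similar 0); rewrite // det22E !mxE /= mul1r mul0r subr0.
have [E10|] := eqVneq (E 1 0) 0; last first.
  by move=> E10; apply: (S_similar 1); rewrite // det22E !mxE /= mul1r mul0r sub0r oppr_eq0.
case/eqP: E0; move/eqP: detE.
rewrite det22E tr0 E01 mul0r subr0 mulrN oppr_eq0 mulf_eq0 orbb => /eqP E00.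
by apply: matrix22P; rewrite !mxE tr0 E00 E01 E10 oppr0.
Qed.

(** The conjugating matrix swaps the two diagonal blocks, because [jordan211] puts the block of size
    2 first. *)
Lemma similar_jordan211 (K : numFieldType) (x : K) (P : 'M[K]_2) :
  similar_in unitmx P (jordan_block x 2) ->
  similar_in unitmx (block_mx (x%:M : 'M_2) 0 0 P) (jordan211 x).
Proof.
move=> [S Su /(similarP Su) SP].
rewrite /jordan211 !jordan_block1 -scalar_mx_block.
have Tu : (block_mx 0 S 1%:M 0 : 'M[K]_(2 + 2)) \in unitmx.
  apply: (proj1 (mulmx1_unit (B := block_mx 0 1%:M (invmx S) 0) _)).
  rewrite mulmx_block !mul0mx !mulmx0 !add0r !addr0 mulmxV // mulmx1.
  by rewrite -scalar_mx_block.
exists (block_mx 0 S 1%:M 0) => //; apply/similarP => //.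
rewrite !mulmx_block !mul0mx !mulmx0 !add0r !addr0 SP mul1mx.
by rewrite mulmx1.
Qed.

(** * Quadruples under simultaneous conjugation *)

Lemma ord3P (j : 'I_3) : [\/ j = 0, j = 1 | j = ord_max].
Proof.
by case: j => [[|[|[|//]]] lt]; [constructor 1|constructor 2|constructor 3]; apply/val_inj.
Qed.

Lemma prod_oneE (K : numFieldType) n (M : quad K n) : prod_one M <->
  M (first3 0) *m M (first3 1) *m M (first3 ord_max) *m M ord_max = 1%:M.
Proof.
rewrite /prod_one !big_ord_recl big_ord0 /= mulmx1 !mulmxA.
set A := _ *m _; set B := _ *m _; suff -> : A = B by [].
by congr (M _ *m M _ *m M _ *m M _); apply/val_inj.
Qed.

Lemma ord4P (j : 'I_4) : j = ord_max \/ exists k, j = first3 k.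
Proof.
case: (unliftP ord_max j) => [k ->|->]; [right|by left].
by exists k; apply/val_inj; rewrite /= /bump leqNgt ltn_ord.
Qed.

Lemma sim_conj_sym (K : numFieldType) n (M M' : quad K n) :
  sim_conj M M' -> sim_conj M' M.
Proof.
move=> [S Su SM]; have S'u : invmx S \in unitmx by rewrite unitmx_inv.
exists (invmx S) => // j; apply/similarP => //; have /(similarP Su) e := SM j.
by rewrite -[M' j](mulmxK Su) -e !mulmxA mulVmx // mul1mx.
Qed.

Lemma prod_one_sim (K : numFieldType) n (M M' : quad K n) :
  sim_conj M M' -> prod_one M' -> prod_one M.
Proof.
move=> [S Su SM] /prod_oneE pM'; apply/prod_oneE.
have e j : M j = invmx S *m M' j *m S.
  by have /(similarP Su) e := SM j; rewrite -mulmxA -e mulKmx.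
have conjM (A B : 'M[K]_n) :
    (invmx S *m A *m S) *m (invmx S *m B *m S) = invmx S *m (A *m B) *m S.
  by rewrite !mulmxA mulmxK.
by rewrite !e !conjM pM' mulmx1 mulVmx.
Qed.

Lemma calU_block (K : numFieldType) (a b : 'I_3 -> K) (M : quad K 4) (N P : quad K 2) :
  (forall j, a j != b j) -> quadN a b N -> quadP a b P ->
  sim_conj M (fun j => block_mx (N j) 0 0 (P j)) -> calU a b M.
Proof.
move=> ab qN qP sM; split; last by exists N, P.
have [Q Qu QM] := sM.
case: qN qP => [dN N4 pN] [dP P4 pP]; split=> [j||].
- by apply: diag_class_similar (diag_class_block (ab j) (dN j) (dP j)); exists Q.
- apply: similar_in_trans (similar_jordan211 P4).
  by exists Q => //; have := QM ord_max; rewrite N4 -raddfN.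
apply: (prod_one_sim sM); apply/prod_oneE.
move/prod_oneE : pN => pN; move/prod_oneE : pP => pP.
have blockM (A B C D : 'M[K]_2) :
    block_mx A 0 0 B *m block_mx C 0 0 D = block_mx (A *m C) 0 0 (B *m D).
  by rewrite mulmx_block !mul0mx !mulmx0 !addr0 add0r.
by rewrite !blockM pN pP -scalar_mx_block.
Qed.

(** * Deforming a 2 by 2 matrix inside its conjugacy class *)

Lemma mxtraceB (R : pzRingType) n (A B : 'M[R]_n) : \tr (A - B) = \tr A - \tr B.
Proof. exact: (raddfB (@mxtrace R n)). Qed.

Section Deformation.
Variables (K : numFieldType) (a b : K) (N R : 'M[K]_2).
Hypotheses (a_neq_b : a != b) (trN : \tr N = a + b) (detN : \det N = a * b).

(** The upper right block of the relation reads [N R + R N = (a + b) R]. The traces of this equation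
    and of its product with [N] form a linear system in [\tr R] and [\tr (N *m R)] of determinant
    [(a - b) ^+ 2]. *)
Lemma tangent_trace :
  ((block_mx N R 0 N - a%:M) *m (block_mx N R 0 N - b%:M) = 0 :> 'M_(2 + 2)) ->
  \tr R = 0 /\ \tr (N *m R) = 0.
Proof.
rewrite !scalar_mx_block !opp_block_mx !add_block_mx mulmx_block !oppr0 !addr0.
rewrite -block_mx0 => /eq_block_mx[_ + _ _].
rewrite mulmxBl mulmxBr mul_scalar_mx mul_mx_scalar => NR0.
have tr1 : 2 * \tr (N *m R) = (a + b) * \tr R.
  have /(congr1 mxtrace) := NR0.
  rewrite !raddfD !raddfN /= !mxtraceZ (mxtrace_mulC R N) mxtrace0 => e.
  by apply/eqP; rewrite -subr_eq0 -e; apply/eqP; ring.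
have tr2 : (a + b) * \tr (N *m R) = 2 * (a * b) * \tr R.
  have /(congr1 (fun A => \tr (N *m A))) := NR0.
  rewrite mulmx0 mxtrace0 mulmxDr !mulmxBr -!scalemxAr mxtraceD !mxtraceB !mxtraceZ.
  have trNNR : \tr (N *m (N *m R)) = (a + b) * \tr (N *m R) - a * b * \tr R.
    rewrite mulmxA Cayley_Hamilton22 mulmxBl -scalemxAl mul_scalar_mx.
    by rewrite mxtraceB !mxtraceZ trN detN.
  rewrite [\tr (N *m (R *m N))]mxtrace_mulC -mulmxA [\tr (R *m _)]mxtrace_mulC -mulmxA trNNR.
  move=> e; apply/eqP; rewrite -subr_eq0 -[X in _ == X]e; apply/eqP; by ring.
have trR : \tr R = 0.
  have : (a - b) ^+ 2 * \tr R = 0.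
    have -> : (a - b) ^+ 2 * \tr R = (a + b) * ((a + b) * \tr R) - 4 * (a * b) * \tr R by ring.
    by rewrite -tr1 mulrCA tr2; ring.
  by move/eqP; rewrite mulf_eq0 expf_eq0 subr_eq0 (negPf a_neq_b) => /eqP.
split=> //; move/eqP: tr1; rewrite trR mulr0 mulf_eq0 pnatr_eq0 => /eqP //.
Qed.

(* Write N = (a + b) / 2 + H, so that H^2 = h^2 with 4 h^2 = (a - b)^2, and
   H R + R H = 0, R^2 = - det R.  With tau = t^2 kappa the matrix
   ((1 - tau) H + t R) / (1 + tau) has square h^2; [slide] is its difference
   quotient at t. *)
Definition kappa := - \det R / (a - b) ^+ 2.

Definition slide t : 'M[K]_2 :=
  (1 + t ^+ 2 * kappa)^-1 *: (R - (t * kappa) *: (2 *: N - (a + b)%:M)).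

Hypotheses (trR : \tr R = 0) (trNR : \tr (N *m R) = 0).

Lemma mxtrace_slide t : \tr (slide t) = 0.
Proof.
by rewrite mxtraceZ mxtraceB mxtraceZ mxtraceB mxtraceZ mxtrace_scalar trR trN; ring.
Qed.

(** As [slide t] has trace zero, [detD22] leaves the terms [- t * \tr (N *m slide t)] and
    [t ^+ 2 * \det (slide t)]; the value of [kappa] makes them cancel. *)
Lemma det_slide t : 1 + t ^+ 2 * kappa != 0 -> \det (N + t *: slide t) = \det N.
Proof.
move=> t0; rewrite detD22 -scalemxAr [\tr (t *: slide t)]mxtraceZ mxtrace_slide.
rewrite [\tr (t *: _)]mxtraceZ detZ.
have -> : \tr (N *m slide t) = - (t * kappa) * (a - b) ^+ 2 / (1 + t ^+ 2 * kappa).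
  rewrite /slide -scalemxAr mxtraceZ mulmxBr -!scalemxAr mulmxBr -scalemxAr.
  rewrite mxtraceB mxtraceZ mxtraceB mxtraceZ mul_mx_scalar mxtraceZ trNR.
  rewrite Cayley_Hamilton22 mxtraceB mxtraceZ mxtrace_scalar trN detN.
  by field.
have detR : \det R = - kappa * (a - b) ^+ 2.
  by rewrite /kappa -mulNr opprK divfK // expf_eq0 subr_eq0 (negPf a_neq_b).
rewrite [\det (slide t)]detZ.
have -> : \det (R - (t * kappa) *: (2 *: N - (a + b)%:M)) =
    - kappa * (a - b) ^+ 2 * (1 + t ^+ 2 * kappa).
  have det2N : \det (2 *: N - (a + b)%:M) = - (a - b) ^+ 2.
    rewrite -scaleN1r -scalemx1 scalerA detD22 -!scalemxAr mulmx1 !detZ det1.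
    by rewrite !mxtraceZ mxtrace1 trN detN; ring.
  have trRN : \tr (R *m (2 *: N - (a + b)%:M)) = 0.
    rewrite mulmxBr -scalemxAr mul_mx_scalar mxtraceB !mxtraceZ.
    by rewrite (mxtrace_mulC R) trNR trR !mulr0 subr0.
  rewrite -scaleNr detD22 -scalemxAr [\tr (_ *: (R *m _))]mxtraceZ trRN trR detZ det2N detR.
  by ring.
by field.
Qed.

(* N Z = a Z and Z N = b Z, hence Z is nilpotent and N + s Z stays annihilated by
   ('X - a)('X - b). *)
Lemma shear_trace_det (L : 'M[K]_2) s (Z := (N - b%:M) *m L *m (N - a%:M)) :
  \tr (N + s *: Z) = \tr N /\ \det (N + s *: Z) = \det N.
Proof.
have N0 : (N - a%:M) *m (N - b%:M) = 0.
  rewrite mulmxBl !mulmxBr Cayley_Hamilton22 trN detN !mul_scalar_mx mul_mx_scalar.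
  by rewrite scale_scalar_mx scalerDl; apply/matrixP => i j; rewrite !mxE; ring.
have NZ : N *m Z = a *: Z.
  apply/eqP; rewrite -subr_eq0 -mul_scalar_mx -mulmxBl /Z !mulmxA N0.
  by rewrite !mul0mx.
have trZ : \tr Z = 0 by rewrite /Z mxtrace_mulC mulmxA N0 mul0mx mxtrace0.
have detZ0 : \det Z = 0.
  rewrite /Z !det_mulmx mulrC mulrA -det_mulmx N0.
  by rewrite -(scale0r 0) detZ expr0n mul0r mul0r.
by rewrite detD22 raddfD /= -scalemxAr NZ !mxtraceZ trZ !detZ detZ0; split; ring.
Qed.

End Deformation.

(** * Absence of a common eigenvector *)

Section Irreducible.
Variables (K : numFieldType) (a b : 'I_3 -> K) (N : quad K 2).
Hypotheses (a_neq_b : forall j, a j != b j) (ab_generic : relatively_generic a b).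
Hypothesis Nab : quadN a b N.

Lemma eigenvalue_diag_class j c (v : 'rV[K]_2) :
  v != 0 -> v *m N (first3 j) = c *: v -> (c == a j) || (c == b j).
Proof.
case: Nab => dN _ _ v0 vN.
have : eigenvalue (N (first3 j)) c by apply/eigenvalueP; exists v.
by rewrite eigenvalue_root_char (dN j).2 rootM !root_exp_XsubC.
Qed.

(* If this product vanished, the N_j would have a common (row) eigenvector, and the
   product of the eigenvalues would contradict genericity for m = 1. *)
Lemma generic_irreducible :
  (N (first3 1) - (a 1)%:M) *m N (first3 0) *m (N (first3 1) - (b 1)%:M) != 0.
Proof.
apply/eqP => NN0.
have [dN N4 pN] := Nab.
have : eigenvalue (N (first3 1)) (b 1).
  by rewrite eigenvalue_root_char (dN 1).2 rootM !root_exp_XsubC eqxx orbT.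
case/eigenvalueP => v vN2 v0.
have [w wE] : exists w, w = v *m N (first3 0) by exists (v *m N (first3 0)).
(* Since [v] is an eigenvector for [b 1], the left factor acts on it as the nonzero scalar
   [b 1 - a 1]; the vanishing product then puts [w] in the same eigenspace. *)
have wN2 : w *m N (first3 1) = b 1 *: w.
  rewrite wE.
  have vNa : v *m (N (first3 1) - (a 1)%:M) = (b 1 - a 1) *: v.
    by rewrite mulmxBr vN2 mul_mx_scalar scalerBl.
  have /(congr1 (mulmx v)) := NN0; rewrite !mulmxA mulmx0 vNa -!scalemxAl.
  move=> /eqP; rewrite scalemx_eq0 subr_eq0 eq_sym (negPf (a_neq_b 1)) /=.
  by rewrite mulmxBr mul_mx_scalar subr_eq0 => /eqP.
have [l vN1] : exists l, v *m N (first3 0) = l *: v.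
  rewrite -wE.
  (* If [v] and [w] were independent, [N (first3 1)] would be the scalar [b 1], against its trace
     [a 1 + b 1]. *)
  have det0 : v 0 0 * w 0 1 - v 0 1 * w 0 0 = 0.
    apply/eqP; apply: contraT => d0.
    pose S : 'M[K]_2 := \matrix_(i, j) (if i == 0 then v 0 j else w 0 j).
    have Su : S \in unitmx by rewrite unitmxE unitfE det22E !mxE.
    have SN : S *m N (first3 1) = b 1 *: S.
      have vE j := congr1 (fun u : 'rV_2 => u 0 j) vN2.
      have wjE j := congr1 (fun u : 'rV_2 => u 0 j) wN2.
      apply: matrix22P; move: (vE 0) (vE 1) (wjE 0) (wjE 1).
      by rewrite !mulmx22E !mxE.
    have N2E : N (first3 1) = (b 1)%:M.
      by rewrite -[LHS](mulKmx Su) SN -scalemxAr mulVmx // scalemx1.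
    have [trN _] := (diag_class22P _ (a_neq_b 1)).1 (dN 1).
    move: trN; rewrite N2E mxtrace_scalar => /eqP.
    by rewrite mulr2n (inj_eq (addIr _)) eq_sym (negPf (a_neq_b 1)).
  have [v00|v00] := eqVneq (v 0 0) 0.
    have v01 : v 0 1 != 0.
      apply: contraNneq v0 => v01; apply/eqP/matrixP => i j; rewrite ord1 mxE.
      by case: (ord2P j) => ->.
    exists (w 0 1 / v 0 1); apply/matrixP => i j; rewrite ord1 mxE.
    case: (ord2P j) => ->; last by rewrite divfK.
    move/eqP: det0; rewrite v00 mul0r sub0r oppr_eq0 mulf_eq0 (negPf v01) /=.
    by move/eqP => ->; rewrite mulr0.
  exists (w 0 0 / v 0 0); apply/matrixP => i j; rewrite ord1 mxE.
  case: (ord2P j) => ->; first by rewrite divfK.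
  by move/eqP: det0; rewrite subr_eq0 => /eqP e; apply: (mulfI v00); rewrite e; field.
have l_ab := eigenvalue_diag_class v0 vN1.
have lb0 : l * b 1 != 0.
  apply/eqP => lb0; case/eqP: v0.
  have /(congr1 (mulmx v)) := (prod_oneE N).1 pN.
  by rewrite !mulmxA vN1 -scalemxAl vN2 scalerA lb0 scale0r !mul0mx mulmx1 => ->.
have vN3 : v *m N (first3 ord_max) = - (l * b 1)^-1 *: v.
  have /(congr1 (mulmx v)) := (prod_oneE N).1 pN.
  rewrite !mulmxA vN1 -scalemxAl vN2 scalerA N4 mulmxN !mulmx1 -scalemxAl => e.
  by apply: (scalerI lb0); rewrite scaleNr scalerN scalerA divff // scale1r -[in RHS]e opprK.
have c_ab := eigenvalue_diag_class v0 vN3.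
set c := - (l * b 1)^-1 in vN3 c_ab.
have lbc : -1 * (l * b 1 * c) = 1 by rewrite /c mulrN divff // mulN1r opprK.
(* [k j] is 1 when the eigenvalue of [N (first3 j)] on [v] is [a j], and 0 when it is [b j]; for the
   index 1 it is [b 1] by the choice of [v]. *)
pose k (j : 'I_3) : nat :=
  if j == 0 then nat_of_bool (l == a 0) else if j == 1 then 0%N else c == a ord_max.
have [//||//] := ab_generic (m := 1) (k := k) isT.
  by move=> j; have [->|->|->] := ord3P j; rewrite /k /=; [case: (l == _)| |case: (c == _)].
rewrite expr1 !big_ord_recl big_ord0.
have -> : lift ord0 ord0 = 1 :> 'I_3 by apply/val_inj.
have -> : lift ord0 (lift ord0 ord0) = ord_max :> 'I_3 by apply/val_inj.
rewrite /k /= expr0 subn0 expr1 !mul1r mulr1 -[RHS]lbc.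
have -> : (a 0 ^+ (l == a 0) * b 0 ^+ (1 - (l == a 0))) = l.
  by case: eqP l_ab => [-> _|_ /= /eqP ->]; rewrite ?expr1 ?expr0 ?mulr1 ?mul1r.
have -> : (a ord_max ^+ (c == a ord_max) * b ord_max ^+ (1 - (c == a ord_max))) = c.
  by case: eqP c_ab => [-> _|_ /= /eqP ->]; rewrite ?expr1 ?expr0 ?mulr1 ?mul1r.
by rewrite mulrA.
Qed.

End Irreducible.

(** * Gluing two quadruples into block triangular form *)

Section Glue.
Variables (K : fieldType) (n : nat) (t : K).
Implicit Types N P : 'M[K]_n.

(* diag(N, P) conjugated by (1 -t^-1; 0 1). *)
Definition glue N P : 'M[K]_(n + n) := block_mx N (t^-1 *: (P - N)) 0 P.

(** Being a conjugate of diag(N, P), [glue] respects products; with [glue_affine] this reaches the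
    third matrix, an affine expression in the product of the others. *)
Lemma glueM N P N' P' : glue N P *m glue N' P' = glue (N *m N') (P *m P').
Proof.
rewrite /glue mulmx_block !mulmx0 !mul0mx !addr0 add0r; congr block_mx.
rewrite -scalemxAl -scalemxAr -scalerDr mulmxBr mulmxBl; congr (_ *: _).
by rewrite addrC addrA subrK.
Qed.

Lemma glue_affine c d N P :
  c%:M - d *: glue N P = glue (c%:M - d *: N) (c%:M - d *: P).
Proof.
rewrite /glue scalar_mx_block scale_block_mx opp_block_mx add_block_mx.
rewrite scaler0 oppr0 addr0 add0r; congr block_mx.
by apply/matrixP => i j; rewrite !mxE; ring.
Qed.

Lemma glue_addZ N D : t != 0 -> glue N (N + t *: D) = block_mx N D 0 (N + t *: D).
Proof. by move=> t0; rewrite /glue addrAC subrr add0r scalerA mulVf // scale1r. Qed.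

(** A single [T] serves all pairs, so the four members of a quadruple are conjugated
    simultaneously. *)
Lemma glue_similar : exists2 T : 'M[K]_(n + n), T \in unitmx &
  forall N P, T *m glue N P = block_mx N 0 0 P *m T.
Proof.
exists (block_mx 1%:M (- (t^-1)%:M) 0 1%:M).
  by rewrite unitmxE det_ublock !det1 mulr1 unitr1.
move=> N P; rewrite /glue !mulmx_block !mulmx0 !mul0mx !mul1mx !mulmx1 !addr0 !add0r.
by rewrite mulNmx mulmxN mul_scalar_mx mul_mx_scalar scalerBr addrAC subrr add0r.
Qed.

End Glue.

(** Multiply the quadratic relation by [C], the inverse of [A]. The third matrix of a quadruple
    thereby becomes affine in the product of the other three, and no matrix inverse enters the
    limits. *)
Lemma annihilate_inv (K : fieldType) n (a b : K) (A C : 'M[K]_n) :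
  (A - a%:M) *m (A - b%:M) = 0 -> C *m A = 1%:M ->
  A = (a + b)%:M - (a * b) *: C.
Proof.
move=> A0 CA; have /(congr1 (mulmx C)) := A0.
have -> : C *m ((A - a%:M) *m (A - b%:M)) = A - ((a + b)%:M - (a * b) *: C).
  rewrite mulmxA [C *m _]mulmxBr CA mul_mx_scalar mulmxBl mul1mx mulmxBr -!scalemxAl CA.
  by rewrite mul_mx_scalar; apply/matrixP => i j; rewrite !mxE; ring.
by rewrite mulmx0 => /eqP; rewrite subr_eq0 => /eqP.
Qed.

(** The increment is exact: the coefficient of [t] keeps the perturbed factors, so its limit at 0 is
    the derivative of the product. *)
Lemma perturb_product (K : fieldType) n t (A B D E C : 'M[K]_n) :
  (- 1%:M + t *: C) *m (A + t *: D) *m (B + t *: E) =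
  - 1%:M *m A *m B + t *: (C *m (A + t *: D) *m (B + t *: E)
                           - D *m (B + t *: E) - A *m E).
Proof.
set P := A + t *: D; set Q := B + t *: E.
have PQ : P *m Q = A *m B + t *: (D *m Q + A *m E).
  rewrite /P mulmxDl {1}/Q mulmxDr -scalemxAl -scalemxAr scalerDr -addrA.
  by rewrite [X in _ + X]addrC.
rewrite 2!mulmxDl !mulNmx !mul1mx -!scalemxAl PQ opprD -addrA -scalerN -scalerDr.
by congr (_ + _ *: _); rewrite opprD addrC addrA.
Qed.

(** * The curve of quadruples through the given point *)

Section Curve.
Variables (K : numFieldType) (a b : 'I_3 -> K).
Hypotheses (a_neq0 : forall j, a j != 0) (b_neq0 : forall j, b j != 0).
Hypothesis a_neq_b : forall j, a j != b j.
Hypothesis prod_ab : \prod_(j < 3) (a j * b j) = 1.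
Variables N R : quad K 2.
Hypothesis Nab : quadN a b N.

Let B (j : 'I_4) : 'M[K]_(2 + 2) := block_mx (N j) (R j) 0 (N j).

Hypothesis dB : forall j, diag_class 2 (a j) (b j) (B (first3 j) : 'M_4).
Hypothesis jB : similar_in unitmx (B ord_max : 'M_4) (jordan211 (-1)).
Hypothesis pB : @prod_one K 4 B.

Local Notation N1 := (N (first3 0)).
Local Notation N2 := (N (first3 1)).
Local Notation N3 := (N (first3 ord_max)).
Local Notation N4 := (N ord_max).
Local Notation R1 := (R (first3 0)).
Local Notation R2 := (R (first3 1)).
Local Notation R3 := (R (first3 ord_max)).
Local Notation R4 := (R ord_max).
Local Notation a3 := (a ord_max).
Local Notation b3 := (b ord_max).

Lemma N4E : N4 = - 1%:M. Proof. by case: Nab. Qed.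

Lemma mxtrace_quadN j : \tr (N (first3 j)) = a j + b j.
Proof. by case: Nab => dN _ _; case/(diag_class22P _ (a_neq_b j)): (dN j). Qed.

Lemma det_quadN j : \det (N (first3 j)) = a j * b j.
Proof. by case: Nab => dN _ _; case/(diag_class22P _ (a_neq_b j)): (dN j). Qed.

Lemma tangent j : \tr (R (first3 j)) = 0 /\ \tr (N (first3 j) *m R (first3 j)) = 0.
Proof.
apply: (tangent_trace (a_neq_b j) (mxtrace_quadN j) (det_quadN j)).
exact: (diag_class_annihilate (n := 3) (dB j)).
Qed.

Lemma B3E : B (first3 ord_max) =
  (a3 + b3)%:M - (a3 * b3) *: (B ord_max *m B (first3 0) *m B (first3 1)).
Proof.
set C := _ *m B (first3 1).
have CB : C *m B (first3 ord_max) = 1%:M.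
  have /prod_oneE/= pB' := pB.
  by have := mulmx1C pB'; rewrite /C !mulmxA.
exact: annihilate_inv (diag_class_annihilate (n := 3) (dB ord_max)) CB.
Qed.

Lemma N3E : N3 = (a3 + b3)%:M - (a3 * b3) *: (N4 *m N1 *m N2).
Proof.
have [dN _ /prod_oneE/= pN] := Nab.
apply: (annihilate_inv (diag_class_annihilate (n := 1) (dN ord_max))).
by have := mulmx1C pN; rewrite !mulmxA.
Qed.

(** Upper right block of [B3E]: the tangent form of the product relation. *)
Lemma R3E : R3 = - (a3 * b3) *: (R4 *m N1 *m N2 - R1 *m N2 - N1 *m R2).
Proof.
have := B3E; rewrite /B !mulmx_block !mulmx0 !mul0mx !addr0 !add0r.
rewrite scalar_mx_block scale_block_mx opp_block_mx add_block_mx.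
case/eq_block_mx => _ -> _ _.
rewrite N4E !mulNmx !mul1mx add0r scaleNr mulmxDl mulNmx.
by rewrite addrC [- _ + _]addrC.
Qed.

(** Here [C] is the inverse of [N (first3 j)], which therefore equals [(a j + b j) - a j b j C];
    pair this with the tangent vector and use [tangent]. *)
Lemma mxtrace_inv_tangent j (C : 'M[K]_2) :
  C *m N (first3 j) = 1%:M -> \tr (C *m R (first3 j)) = 0.
Proof.
move=> CN; have [dN _ _] := Nab; have [trR trNR] := tangent j.
have := annihilate_inv (diag_class_annihilate (n := 1) (dN j)) CN.
move/(congr1 (fun A => \tr (A *m R (first3 j)))).
rewrite trNR mulmxBl mul_scalar_mx -scalemxAl mxtraceB !mxtraceZ trR mulr0 sub0r.
move/esym/eqP; rewrite oppr_eq0 !mulf_eq0 (negPf (a_neq0 _)) (negPf (b_neq0 _)).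
by move/eqP.
Qed.

(** Expand [\tr (N3 *m R3) = 0] by [R3E]. The terms in [R1] and [R2] pair a tangent vector with the
    inverse of [N1] or [N2] and vanish; the remaining one is [- \tr R4]. *)
Lemma mxtrace_R4 : \tr R4 = 0.
Proof.
have [_ _ /prod_oneE/= pN] := Nab.
have pN3 : N1 *m N2 *m N3 = - 1%:M.
  by move: pN; rewrite N4E mulmxN mulmx1 => <-; rewrite opprK.
have C1 : (- (N2 *m N3)) *m N1 = 1%:M.
  by apply: mulmx1C; rewrite mulmxN mulmxA pN3 opprK.
have C2 : (- (N3 *m N1)) *m N2 = 1%:M.
  rewrite mulNmx -mulmxA; apply/eqP; rewrite -eqr_opp opprK; apply/eqP.
  have : (- N3) *m (N1 *m N2) = 1%:M.
    by apply: mulmx1C; rewrite mulmxN pN3 opprK.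
  by rewrite mulNmx => <-; rewrite opprK.
have trC1 := mxtrace_inv_tangent C1.
have trC2 := mxtrace_inv_tangent C2.
have [_] := tangent ord_max.
rewrite R3E -scalemxAr mxtraceZ => /eqP; rewrite mulf_eq0 oppr_eq0 mulf_eq0.
rewrite (negPf (a_neq0 _)) (negPf (b_neq0 _)) /= => /eqP.
rewrite !mulmxBr !mxtraceB.
have -> : \tr (N3 *m (R4 *m N1 *m N2)) = - \tr R4.
  by rewrite mxtrace_mulC -!mulmxA (mulmxA N1) pN3 mulmxN mulmx1 raddfN.
have -> : \tr (N3 *m (R1 *m N2)) = 0.
  rewrite mxtrace_mulC -mulmxA mxtrace_mulC; move: trC1; rewrite mulNmx raddfN => /eqP.
  by rewrite oppr_eq0 => /eqP.
have -> : \tr (N3 *m (N1 *m R2)) = 0.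
  rewrite mulmxA; move: trC2; rewrite mulNmx raddfN => /eqP.
  by rewrite oppr_eq0 => /eqP.
by rewrite !subr0 => /eqP; rewrite oppr_eq0 => /eqP.
Qed.

(** Conjugation preserves rank, and after adding the identity [B ord_max] keeps only the block [R4],
    while [jordan211 (-1)] keeps a single entry 1. *)
Lemma mxrank_R4 : \rank R4 = 1%N.
Proof.
have [S Su /(similarP Su) SB] := jB.
have SE : S *m (B ord_max + 1%:M) = (jordan211 (-1) + 1%:M) *m S.
  by rewrite mulmxDr mulmxDl SB mulmx1 mul1mx.
have : \rank (B ord_max + 1%:M : 'M_4)%R = \rank (jordan211 (-1) + 1%:M : 'M[K]_4)%R.
  have := congr1 mxrank SE.
  by rewrite [RHS]mxrankMfree ?row_free_unit // eqmxMfull // row_full_unit.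
have -> : B ord_max + 1%:M = block_mx 0 R4 0 0.
  by rewrite /B N4E scalar_mx_block add_block_mx !addNr !addr0.
have -> : jordan211 (-1) + 1%:M = block_mx (delta_mx 0 1 : 'M[K]_2) 0 0 (0 : 'M_2).
  suff : block_mx (jordan_block (-1) 2) 0 0 (-1)%:M + 1%:M =
      block_mx (delta_mx 0 1) 0 0 0 :> 'M[K]_(2 + 2).
    by rewrite /jordan211 !jordan_block1 -scalar_mx_block.
  rewrite scalar_mx_block add_block_mx !addr0 -raddfD addNr raddf0; congr block_mx.
  by apply: matrix22P; rewrite !mxE /=; split; ring.
have rank_ur (X : 'M[K]_2) : \rank (block_mx 0 X 0 0 : 'M_(2 + 2)) = \rank X.
  by rewrite /block_mx row_mx0 rank_col_mx0 rank_row_0mx.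
have rank_ul (X : 'M[K]_2) : \rank (block_mx X 0 0 0 : 'M_(2 + 2)) = \rank X.
  by rewrite /block_mx row_mx0 rank_col_mx0 rank_row_mx0.
move=> e; transitivity (\rank (delta_mx 0 1 : 'M[K]_2)); last exact: mxrank_delta.
by rewrite -[RHS]rank_ul -[LHS]rank_ur; exact: e.
Qed.

Lemma det_R4 : \det R4 = 0.
Proof.
apply/eqP; apply: contraT; rewrite -unitfE -unitmxE -row_full_unit /row_full.
by rewrite mxrank_R4.
Qed.

Lemma R4_neq0 : R4 != 0.
Proof. by rewrite -mxrank_eq0 mxrank_R4. Qed.

Variable L : 'M[K]_2.
(** Up to sign this trace is the limit [h0] of [h], so the linear equation for [s] stays solvable
    near 0. *)
Hypothesis L_neq0 : \tr (N1 *m (N2 - (b 1)%:M) *m L *m (N2 - (a 1)%:M)) != 0.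

(* P2 is the curve Q2 through N2 corrected by t s(t) Z(t), where s solves the
   linear equation tr (P4 P1 P2) = tr (N4 N1 N2); the trace of P4 P1 Q2 exceeds
   the required one by t g(t). *)
Let D1 t := slide (a 0) (b 0) N1 R1 t.
Let S2 t := slide (a 1) (b 1) N2 R2 t.
Let P1 t := N1 + t *: D1 t.
Let Q2 t := N2 + t *: S2 t.
Let P4 t := N4 + t *: R4.
Let Z t := (Q2 t - (b 1)%:M) *m L *m (Q2 t - (a 1)%:M).
Let g t := \tr (R4 *m P1 t *m Q2 t - D1 t *m Q2 t - N1 *m S2 t).
Let h t := \tr (P4 t *m P1 t *m Z t).
Let s t := - g t / h t.
Let D2 t := S2 t + s t *: Z t.
Let P2 t := N2 + t *: D2 t.
Let Q t := P4 t *m P1 t *m P2 t.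
Let P3 t := (a3 + b3)%:M - (a3 * b3) *: Q t.

Let F1 t : 'M[K]_(2 + 2) := block_mx N1 (D1 t) 0 (P1 t).
Let F2 t : 'M[K]_(2 + 2) := block_mx N2 (D2 t) 0 (P2 t).
Let F4 t : 'M[K]_(2 + 2) := block_mx N4 R4 0 (P4 t).
(** Same affine expression as in [B3E], so that its limit follows from those of the other three. *)
Let F3 t : 'M[K]_(2 + 2) := (a3 + b3)%:M - (a3 * b3) *: (F4 t *m F1 t *m F2 t).

Let P t : quad K 2 := fun j => nth 0 [:: P1 t; P2 t; P3 t; P4 t] j.
Let F t : quad K 4 := fun j => nth 0 [:: F1 t; F2 t; F3 t; F4 t] j.

(** The denominators of the curve do not vanish; [t != 0] also keeps [P4 t] from being scalar. *)
Let admissible t := [/\ t != 0, 1 + t ^+ 2 * kappa (a 0) (b 0) R1 != 0,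
   1 + t ^+ 2 * kappa (a 1) (b 1) R2 != 0 & h t != 0].

Lemma quadP_deform t : admissible t -> quadP a b (P t).
Proof.
case=> t0 k1 k2 h0.
have [trP1 detP1] : \tr (P1 t) = a 0 + b 0 /\ \det (P1 t) = a 0 * b 0.
  rewrite /P1 mxtraceD mxtraceZ (mxtrace_slide (mxtrace_quadN 0)) ?(tangent 0).1 // mulr0 addr0.
  rewrite (det_slide (a_neq_b 0) (mxtrace_quadN 0) (det_quadN 0)) ?(tangent 0).1 ?(tangent 0).2 //.
  by rewrite mxtrace_quadN det_quadN.
have [trQ2 detQ2] : \tr (Q2 t) = a 1 + b 1 /\ \det (Q2 t) = a 1 * b 1.
  rewrite /Q2 mxtraceD mxtraceZ (mxtrace_slide (mxtrace_quadN 1)) ?(tangent 1).1 // mulr0 addr0.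
  rewrite (det_slide (a_neq_b 1) (mxtrace_quadN 1) (det_quadN 1)) ?(tangent 1).1 ?(tangent 1).2 //.
  by rewrite mxtrace_quadN det_quadN.
have P2E : P2 t = Q2 t + (t * s t) *: Z t.
  by rewrite /P2 /D2 scalerDr addrA scalerA.
have [trP2 detP2] : \tr (P2 t) = a 1 + b 1 /\ \det (P2 t) = a 1 * b 1.
  by rewrite P2E; have [-> ->] := shear_trace_det trQ2 detQ2 L (t * s t).
have R40 := R4_neq0.
have detP4 : \det (P4 t) = 1.
  rewrite /P4 detD22 N4E detZ det_R4 mxtraceZ mxtrace_R4 mulNmx mul1mx -scaleNr mxtraceZ mxtrace_R4.
  by rewrite -scaleN1r detZ det1; ring.
have detQ : \det (Q t) * (a3 * b3) = 1.
  rewrite !det_mulmx detP1 detP2 detP4 mul1r -prod_ab !big_ord_recl big_ord0.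
  have -> : lift ord0 ord0 = 1 :> 'I_3 by apply/val_inj.
  have -> : lift ord0 (lift ord0 ord0) = ord_max :> 'I_3 by apply/val_inj.
  by ring.
(* The choice of [s] cancels the excess [t * g t], leaving the trace of [N4 *m N1 *m N2], which
   [N3E] determines. *)
have trQ : a3 * b3 * \tr (Q t) = a3 + b3.
  have trN3 := congr1 mxtrace N3E; rewrite mxtrace_quadN mxtraceB mxtraceZ mxtrace_scalar in trN3.
  have -> : \tr (Q t) = \tr (N4 *m N1 *m N2).
    rewrite /Q P2E mulmxDr mxtraceD -scalemxAr mxtraceZ -/(h t).
    have -> : \tr (P4 t *m P1 t *m Q2 t) = \tr (N4 *m N1 *m N2) + t * g t.
      rewrite -mxtraceZ -mxtraceD; congr mxtrace.
      by rewrite /P4 N4E; exact: perturb_product.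
    by rewrite /s -mulrA divfK // mulrN addrK.
  set T := \tr _ in trN3 *.
  have -> : a3 * b3 * T = (a3 + b3) *+ 2 - ((a3 + b3) *+ 2 - a3 * b3 * T) by ring.
  by rewrite -trN3; ring.
(* By [trQ] and [detQ], this is Cayley-Hamilton for [Q t] multiplied by [a3 * b3]. *)
have P3Q : P3 t *m Q t = 1%:M.
  rewrite /P3 mulmxBl -scalemxAl Cayley_Hamilton22 mul_scalar_mx scalerBr scalerA trQ.
  by rewrite opprB addrCA subrr addr0 scale_scalar_mx mulrC detQ.
split.
- move=> j; apply/(diag_class22P _ (a_neq_b j)).
  have [->|->|->] := ord3P j => //.
  split; first by rewrite mxtraceB mxtraceZ trQ mxtrace_scalar; ring.
  have := congr1 determinant P3Q; rewrite det_mulmx det1 -detQ mulrC.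
  apply: mulfI; apply: contraTneq isT => dQ0.
  by move/eqP: detQ; rewrite dQ0 mul0r eq_sym oner_eq0.
- have -> : P t ord_max = (-1)%:M + t *: R4 by rewrite raddfN -N4E.
  apply: similar_jordan_block2; first by rewrite scalemx_eq0 negb_or t0.
    by rewrite mxtraceZ mxtrace_R4 mulr0.
  by rewrite detZ det_R4 mulr0.
apply/prod_oneE; rewrite /=.
apply: mulmx1C; rewrite !mulmxA; apply: mulmx1C; exact: P3Q.
Qed.

(** Three components are glued by construction; the third follows because [glue] commutes with
    products and with the affine expression defining [F3] and [P3]. *)
Lemma deform_glue t (j : 'I_4) : t != 0 -> F t j = glue t (N j) (P t j).
Proof.
move=> t0; have [->|[k ->]] := ord4P j; first by rewrite glue_addZ.
have [->|->|->] := ord3P k; [by rewrite glue_addZ | by rewrite glue_addZ |].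
rewrite [RHS](_ : _ = glue t N3 (P3 t)) // N3E /P3 -glue_affine -!glueM.
by rewrite !glue_addZ.
Qed.

(** * Limits along the curve *)

Let cvgt : t @[t --> (0 : K)^'] --> (0 : K).
Proof. exact: nbhs_dnbhs. Qed.

Let cvg_den c d A : (1 + t ^+ 2 * @kappa K c d A) @[t --> (0 : K)^'] --> (1 : K).
Proof.
rewrite -[X in _ --> X]addr0 -[X in _ + X](mul0r (kappa c d A)).
apply: cvgD; first exact: cvg_cst.
apply: cvgM; last exact: cvg_cst.
rewrite -[X in _ --> X](mul0r 0); exact: cvgM.
Qed.

Let cvg_slide c d A E : slide c d A E t @[t --> (0 : K)^'] --> E.
Proof.
have {2}-> : E = 1^-1 *: (E - (0 * kappa c d E) *: (2 *: A - (c + d)%:M)).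
  by rewrite invr1 scale1r mul0r scale0r subr0.
apply: cvgZ; first by apply: cvgV (oner_neq0 _) (cvg_den _ _ _).
apply: cvgB; first exact: cvg_cst.
apply: cvgZ; last exact: cvg_cst.
by apply: cvgM; last exact: cvg_cst.
Qed.

Let cvg_addZ (A : 'M[K]_2) (f : K -> 'M[K]_2) (E : 'M[K]_2) :
  f @ (0 : K)^' --> E -> A + t *: f t @[t --> (0 : K)^'] --> A.
Proof.
move=> fE; rewrite -[X in _ --> X]addr0 -[X in _ + X](scale0r E).
by apply: cvgD; [exact: cvg_cst | exact: cvgZ].
Qed.

Let cvgP1 : P1 @ (0 : K)^' --> N1. Proof. by apply: (cvg_addZ (E := R1)); exact: cvg_slide. Qed.
Let cvgQ2 : Q2 @ (0 : K)^' --> N2. Proof. by apply: (cvg_addZ (E := R2)); exact: cvg_slide. Qed.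
Let cvgP4 : P4 @ (0 : K)^' --> N4. Proof. by apply: (cvg_addZ (E := R4)); exact: cvg_cst. Qed.

Let cvgZ0 : Z @ (0 : K)^' --> (N2 - (b 1)%:M) *m L *m (N2 - (a 1)%:M).
Proof.
apply: cvg_mulmx; first apply: cvg_mulmx.
- by apply: cvgB; [exact: cvgQ2 | exact: cvg_cst].
- exact: cvg_cst.
- by apply: cvgB; [exact: cvgQ2 | exact: cvg_cst].
Qed.

Let h0 := \tr (N4 *m N1 *m ((N2 - (b 1)%:M) *m L *m (N2 - (a 1)%:M))).

Let cvgh : h @ (0 : K)^' --> h0.
Proof.
apply: cvg_mxtrace; apply: cvg_mulmx cvgZ0; exact: cvg_mulmx cvgP4 cvgP1.
Qed.

Let h0_neq0 : h0 != 0.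
Proof.
by rewrite /h0 N4E mulNmx mul1mx mulNmx raddfN oppr_eq0 !mulmxA.
Qed.

(** The limit is the trace of the matrix that [R3E] multiplies by [- (a3 * b3)] to get [R3], and
    [R3] has trace zero: tangency in the third class is what makes the correction [s] tend to 0. *)
Let cvgg : g @ (0 : K)^' --> (0 : K).
Proof.
have trS : \tr (R4 *m N1 *m N2 - R1 *m N2 - N1 *m R2) = 0.
  have [+ _] := tangent ord_max; rewrite R3E mxtraceZ => /eqP.
  rewrite mulf_eq0 oppr_eq0 mulf_eq0 (negPf (a_neq0 _)) (negPf (b_neq0 _)).
  by move/eqP.
rewrite -[X in _ --> X]trS; apply: cvg_mxtrace; apply: cvgB; first apply: cvgB.
- by apply: cvg_mulmx; [apply: cvg_mulmx; [exact: cvg_cst | exact: cvgP1] | exact: cvgQ2].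
- by apply: cvg_mulmx; [exact: cvg_slide | exact: cvgQ2].
- by apply: cvg_mulmx; [exact: cvg_cst | exact: cvg_slide].
Qed.

Let cvgs : s @ (0 : K)^' --> (0 : K).
Proof.
rewrite [X in _ --> X](_ : 0 = - 0 / h0); last by rewrite oppr0 mul0r.
apply: cvgM; first exact: cvgN.
exact: cvgV.
Qed.

Let cvgD2 : D2 @ (0 : K)^' --> R2.
Proof.
rewrite -[X in _ --> X]addr0 -[X in _ + X](scale0r ((N2 - (b 1)%:M) *m L *m (N2 - (a 1)%:M))).
by apply: cvgD; [exact: cvg_slide | exact: cvgZ cvgs cvgZ0].
Qed.

Let cvgF1 : F1 @ (0 : K)^' --> B (first3 0).
Proof. by apply: cvg_block_mx; [exact: cvg_cst | exact: cvg_slide | exact: cvg_cst |]. Qed.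

Let cvgF2 : F2 @ (0 : K)^' --> B (first3 1).
Proof. by apply: cvg_block_mx; [exact: cvg_cst | | exact: cvg_cst | exact: cvg_addZ cvgD2]. Qed.

Let cvgF4 : F4 @ (0 : K)^' --> B ord_max.
Proof. by apply: cvg_block_mx; [exact: cvg_cst | exact: cvg_cst | exact: cvg_cst |]. Qed.

Lemma cvg_deform j : F t j @[t --> 0^'] --> (B j : 'M[K]_4).
Proof.
have [->|[k ->]] := ord4P j; first exact: cvgF4.
have [->|->|->] := ord3P k; [exact: cvgF1 | exact: cvgF2 |].
rewrite B3E; apply: cvgB; first exact: cvg_cst.
apply: cvgZ; first exact: cvg_cst.
by apply: cvg_mulmx; [exact: cvg_mulmx | exact: cvgF2].
Qed.

Lemma near_admissible : \forall t \near (0 : K)^', admissible t.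
Proof.
near=> t; split.
- by near: t; exact: nbhs_dnbhs_neq.
- by near: t; exact: cvgr_neq0 (cvg_den _ _ _) (oner_neq0 _).
- by near: t; exact: cvgr_neq0 (cvg_den _ _ _) (oner_neq0 _).
- by near: t; exact: cvgr_neq0 cvgh h0_neq0.
Unshelve. all: by end_near. Qed.

Lemma closure_deform (M : quad K 4) :
  sim_conj M B -> closure (calU a b) M.
Proof.
move=> [S Su SM]; pose f t : quad K 4 := fun j => invmx S *m F t j *m S.
apply: (closure_cvg (f := f)) => [j|].
  have -> : M j = invmx S *m B j *m S.
    by have /(similarP Su) e := SM j; rewrite -mulmxA -e mulKmx.
  apply: cvg_mulmx; last exact: cvg_cst.
  by apply: cvg_mulmx; [exact: cvg_cst | exact: cvg_deform].
apply: filterS near_admissible => t tadmissible; have [t0 _ _ _] := tadmissible.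
apply: (calU_block a_neq_b Nab (quadP_deform tadmissible)).
have [T Tu TE] := @glue_similar K 2 t.
exists (T *m S); first by rewrite unitmx_mul Tu.
move=> j; apply/similarP; first by rewrite unitmx_mul Tu.
rewrite /f deform_glue // !mulmxA mulmxK //; congr (mulmx _ _).
exact: TE.
Qed.

End Curve.

(** * Choice of the correction and conclusion *)

Lemma mxtrace_mul_delta (R : pzRingType) n (A : 'M[R]_n) i j :
  \tr (A *m delta_mx j i) = A i j.
Proof.
rewrite /mxtrace (bigD1 i) //= [X in _ + X]big1 ?addr0 => [|k ki].
  rewrite mxE (bigD1 j) //= mxE !eqxx mulr1 big1 ?addr0 // => k kj.
  by rewrite mxE (negPf kj) mulr0.
rewrite mxE big1 // => l _.
by rewrite mxE (negPf ki) andbF mulr0.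
Qed.

Lemma calW_closure (K : numFieldType) (a b : 'I_3 -> K) :
  (forall j, a j != 0) -> (forall j, b j != 0) -> (forall j, a j != b j) ->
  \prod_(j < 3) (a j * b j) = 1 -> relatively_generic a b ->
  calW a b `<=` closure (calU a b).
Proof.
move=> a0 b0 ab prod_ab gen M [[dM jM pM] [N [R [Nab MB]]]].
have BM := sim_conj_sym MB.
have similarBM j : similar_in unitmx (block_mx (N j) (R j) 0 (N j) : 'M_4) (M j).
  by have [S Su SE] := BM; exists S.
(* Cyclicity of the trace turns this into the pairing of [L] with the nonzero matrix of
   [generic_irreducible]; an elementary matrix picks out a nonzero entry. *)
have [L L0] : exists L : 'M[K]_2, \tr (N (first3 0) *m (N (first3 1) - (b 1)%:M) *m L
    *m (N (first3 1) - (a 1)%:M)) != 0.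
  have := generic_irreducible ab gen Nab; set X := _ *m (_ - (b 1)%:M) => X0.
  have [i [j Xij]] : exists i j, X i j != 0.
    by have /matrix0Pn := X0.
  exists (delta_mx j i).
  by rewrite mxtrace_mulC !mulmxA -/X mxtrace_mul_delta.
apply: (closure_deform a0 b0 ab prod_ab Nab _ _ _ L0 MB).
- by move=> j; apply: diag_class_similar (dM j).
- exact: similar_in_trans (similarBM ord_max) jM.
- exact: prod_one_sim BM pM.
Qed.

Unset Implicit Arguments.

Theorem proposition22 (R : realType) (a b : 'I_3 -> R[i])
    (a_neq0 : forall j, a j != 0) (b_neq0 : forall j, b j != 0)
    (a_neq_b : forall j, a j != b j)
    (prod_ab : \prod_(j < 3) (a j * b j) = 1)
    (ab_generic : relatively_generic a b) :
  calW a b `<=` closure (calU a b).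
Proof. exact: calW_closure. Qed.
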